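(* Let $\mathcal N=\{1,\dots,n\}$ be a universe of products with prices $p_1\ge\cdots\ge p_n\ge0$ and preference weights $v_1,\dots,v_n>0$. The expanded revenue function $\overline R:2^{\mathcal N}\to\mathbb R$ is supermodular, i.e., for every $A\subseteq B\subseteq\mathcal N$ and $i\in\mathcal N\setminus B$, $$\overline R(B\cup\{i\})-\overline R(B)\ \ge\ \overline R(A\cup\{i\})-\overline R(A).$$
   Context: For an assortment $S\subseteq\mathcal N$, the MNL expected revenue is $R(S)=\frac{\sum_{i\in S}p_iv_i}{1+\sum_{i\in S}v_i}$. The expanded revenue of $A\subseteq\mathcal N$ is $\overline R(A)=\max\{R(S): A\subseteq S\subseteq\mathcal N\}$. *)

(* Defs.v *)
From mathcomp Require Import all_boot all_order all_algebra.
Set Implicit Arguments.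
Unset Strict Implicit.
Unset Printing Implicit Defensive.
Import Order.TTheory GRing.Theory Num.Theory.
Local Open Scope ring_scope.

(* Everything is stated over an arbitrary ordered field R; the real numbers
   are an instance. Products are indexed from 0: the universe is 'I_n. *)

Definition revenue (R : realFieldType) (n : nat) (p v : 'I_n -> R)
    (S : {set 'I_n}) : R :=
  (\sum_(i in S) p i * v i) / (1 + \sum_(i in S) v i).

(* The default value [revenue p v A] of the iterated maximum is itself one of
   the candidates (S = A), so this is the true maximum over all S containing A,
   whatever the signs of the revenues. *)
Definition expanded_revenue (R : realFieldType) (n : nat) (p v : 'I_n -> R)
    (A : {set 'I_n}) : R :=
  \big[Num.max/revenue p v A]_(S : {set 'I_n} | A \subset S) revenue p v S.

Definition supermodular (R : realFieldType) (T : finType) (f : {set T} -> R)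
    : Prop :=
  forall (A B : {set T}) (i : T), A \subset B -> i \notin B ->
    f (i |: B) - f B >= f (i |: A) - f A.

(* Main.v *)
Require Import Defs.
From mathcomp Require Import all_boot all_order all_algebra.
From mathcomp Require Import lra.
Set Implicit Arguments.
Unset Strict Implicit.
Unset Printing Implicit Defensive.
Import Order.TTheory GRing.Theory Num.Theory.
Local Open Scope ring_scope.

(** A revenue [revenue p v S] is at most [z] exactly when the sum over [S] of
    [v j * (p j - z)] is at most [z].  For a fixed [z], the set [S] containing
    [A] that makes this sum largest consists of [A] and of the products priced
    above [z], so the expanded revenue of [A] is the zero of
    [excess A z = \sum_j v j * (p j - z or its positive part) - z], the positive
    part being taken for [j] outside [A] ([excess_expanded_revenue]).

    The function [excess A] is strictly decreasing and convex, and it gets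
    steeper when [A] grows; [excess_drop] packs convexity and steepening into
    one inequality.  Moreover, adding [i] to [A] lowers [excess A z] by
    [v i * max (z - p i) 0], an amount that does not depend on [A] and is
    nondecreasing in [z].

    Write [a, a', b, b'] for the expanded revenues of [A], [i |: A], [B],
    [i |: B].  Then [excess A] has to drop by [v i * max (a' - p i) 0] to go
    from [a'] to its zero [a], and [excess B] by [v i * max (b' - p i) 0] to go
    from [b'] to [b].  Since [b' <= a'], the first drop is the larger one, and
    it takes place on the flatter curve and further to the right, where that
    curve is flatter still; hence it needs more room: [b - b' <= a - a']. *)

Section Excess.

Variables (R : realFieldType) (n : nat) (p v : 'I_n -> R).
Hypothesis v_gt0 : forall i : 'I_n, 0 < v i.

Implicit Types (A B S : {set 'I_n}) (x y z : R).

Definition excess A z : R :=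
  \sum_j v j * (if j \in A then p j - z else Num.max (p j - z) 0) - z.

Lemma attraction_gt0 S : 0 < 1 + \sum_(j in S) v j.
Proof. by rewrite ltr_wpDr ?ltr01 // sumr_ge0 // => j _; apply: ltW. Qed.

Lemma revenueE S z :
  revenue p v S - z =
  (\sum_(j in S) v j * (p j - z) - z) / (1 + \sum_(j in S) v j).
Proof.
have den_gt0 := attraction_gt0 S.
have -> : \sum_(j in S) v j * (p j - z) =
          \sum_(j in S) p j * v j - z * \sum_(j in S) v j.
  rewrite mulr_sumr -sumrB; apply: eq_bigr => j _.
  by rewrite mulrBr mulrC [v j * z]mulrC.
apply: (mulIf (lt0r_neq0 den_gt0)).
rewrite /revenue mulrBl !divfK ?lt0r_neq0 //.
by rewrite mulrDr mulr1 opprD addrA addrAC.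
Qed.

Lemma revenue_le S z :
  (revenue p v S <= z) = (\sum_(j in S) v j * (p j - z) <= z).
Proof.
rewrite -subr_le0 revenueE pmulr_lle0 ?subr_le0 // invr_gt0.
exact: attraction_gt0.
Qed.

Lemma revenue_ge S z :
  (z <= revenue p v S) = (z <= \sum_(j in S) v j * (p j - z)).
Proof.
rewrite -subr_ge0 revenueE pmulr_lge0 ?subr_ge0 // invr_gt0.
exact: attraction_gt0.
Qed.

Lemma sum_le_excess A S z :
  A \subset S -> \sum_(j in S) v j * (p j - z) - z <= excess A z.
Proof.
move=> sAS; rewrite lerD2r big_mkcond ler_sum // => j _.
have := v_gt0 j; have [/(subsetP sAS) -> //|_] := boolP (j \in A).
case: ifP => _ vj_gt0 /=; first by rewrite ler_pM2l // le_max lexx.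
by rewrite (mulr_ge0 (ltW vj_gt0)) // le_max lexx orbT.
Qed.

Lemma excess_sum A z :
  excess A z =
  \sum_(j in A :|: [set j | z < p j]) v j * (p j - z) - z.
Proof.
congr (_ - _); rewrite [RHS]big_mkcond; apply: eq_bigr => j _.
rewrite !inE; case: (j \in A) => //=.
have [z_lt|p_le] := ltP z (p j); first by rewrite max_l // subr_ge0 ltW.
by rewrite max_r ?mulr0 // subr_le0.
Qed.

Lemma expanded_revenue_ge A S :
  A \subset S -> revenue p v S <= expanded_revenue p v A.
Proof. by move=> sAS; rewrite /expanded_revenue (bigD1 S) //= le_max lexx. Qed.

Lemma expanded_revenue_attained A :
  exists2 S : {set 'I_n}, A \subset S & expanded_revenue p v A = revenue p v S.
Proof.
rewrite /expanded_revenue; elim/big_ind: _ => [|x y [S sS ->] [T sT ->]|S sAS].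
- by exists A.
- by case: (leP (revenue p v S) (revenue p v T)) => _; [exists T | exists S].
- by exists S.
Qed.

Lemma expanded_revenue_anti A B :
  A \subset B -> expanded_revenue p v B <= expanded_revenue p v A.
Proof.
move=> sAB; have [S sBS ->] := expanded_revenue_attained B.
exact/expanded_revenue_ge/(subset_trans sAB).
Qed.

(** A maximising assortment shows that the excess at the expanded revenue is
    nonnegative; the assortment made of [A] and of the products priced above
    the expanded revenue cannot beat the maximum, which shows that the excess
    is nonpositive. *)
Lemma excess_expanded_revenue A : excess A (expanded_revenue p v A) = 0.
Proof.
apply/eqP; rewrite eq_le; apply/andP; split.
  by rewrite excess_sum subr_le0 -revenue_le expanded_revenue_ge ?subsetUl.
have [S sAS rE] := expanded_revenue_attained A.
apply: le_trans (sum_le_excess _ sAS).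
by rewrite subr_ge0 -revenue_ge rE.
Qed.

(** Term by term: for [j] in [A] both sides drop by [v j * d]; for [j] in [B]
    only, the right-hand drop is the largest possible, [v j * d]; for [j]
    outside [B], this is convexity of the positive part. *)
Lemma excess_drop A B x y d :
  A \subset B -> x <= y -> 0 <= d ->
  excess A y - excess A (y + d) <= excess B x - excess B (x + d).
Proof.
move=> sAB x_le_y d_ge0.
have drop_terms (C : {set 'I_n}) z :
    excess C z - excess C (z + d) =
    \sum_j v j * ((if j \in C then p j - z else Num.max (p j - z) 0)
      - (if j \in C then p j - (z + d) else Num.max (p j - (z + d)) 0)) + d.
  rewrite (eq_bigr _ (fun j _ => mulrBr _ _ _)) sumrB /excess; lra.
rewrite !drop_terms lerD2r ler_sum // => j _.
rewrite ler_pM2l //; have [/(subsetP sAB) ->|_] := boolP (j \in A); first lra.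
by case: (j \in B);
  case: (leP (p j - y) 0); case: (leP (p j - (y + d)) 0);
  case: (leP (p j - x) 0); case: (leP (p j - (x + d)) 0); lra.
Qed.

Lemma excess_decr A x y : x < y -> excess A y < excess A x.
Proof.
move=> x_lt_y; apply: ler_ltD; last by rewrite ltrN2.
apply: ler_sum => j _; rewrite ler_pM2l //; case: ifP => _; first lra.
by case: (leP (p j - y) 0); case: (leP (p j - x) 0); lra.
Qed.

Lemma excess_setU1 A i z :
  i \notin A -> excess A z - excess (i |: A) z = v i * Num.max (z - p i) 0.
Proof.
move=> iNA; rewrite /excess (bigD1 i) //= [in X in _ - X](bigD1 i) //=.
rewrite setU11 (negbTE iNA).
under [in X in _ - X]eq_bigr => j ji do rewrite in_setU1 (negbTE ji) /=.
have -> : Num.max (p i - z) 0 = p i - z + Num.max (z - p i) 0.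
  by case: (leP (p i - z) 0); case: (leP (z - p i) 0); lra.
by rewrite mulrDr; lra.
Qed.

End Excess.

Theorem lemma3p5 (R : realFieldType) (n : nat) (p v : 'I_n -> R)
  (p_noninc : forall i j : 'I_n, (i <= j)%N -> p j <= p i)
  (p_ge0 : forall i : 'I_n, 0 <= p i)
  (v_gt0 : forall i : 'I_n, 0 < v i) :
  supermodular (expanded_revenue p v).
Proof.
move=> A B i sAB iNB; have iNA : i \notin A by apply: contra iNB; apply/subsetP.
have b'_le_b := expanded_revenue_anti p v (subsetU1 i B).
have b'_le_a' := expanded_revenue_anti p v (setUS [set i] sAB).
have Fa := excess_expanded_revenue p v_gt0 A.
have Fb := excess_expanded_revenue p v_gt0 B.
have Fa' := excess_expanded_revenue p v_gt0 (i |: A).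
have Fb' := excess_expanded_revenue p v_gt0 (i |: B).
move: b'_le_b b'_le_a' Fa Fb Fa' Fb'.
set a := expanded_revenue p v A; set b := expanded_revenue p v B.
set a' := expanded_revenue p v (i |: A).
set b' := expanded_revenue p v (i |: B).
move=> b'_le_b b'_le_a' Fa Fb Fa' Fb'.
have d_ge0 : 0 <= b - b' by rewrite subr_ge0.
have drop := excess_drop p v_gt0 sAB b'_le_a' d_ge0.
rewrite [b' + _]addrC subrK Fb in drop.
have jumpA := excess_setU1 p v a' iNA; rewrite Fa' in jumpA.
have jumpB := excess_setU1 p v b' iNB; rewrite Fb' in jumpB.
have jump_le : v i * Num.max (b' - p i) 0 <= v i * Num.max (a' - p i) 0.
  by rewrite ler_pM2l // ge_max !le_max lerD2r b'_le_a' lexx orbT.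
(* [excess A] is still nonnegative at [a' + (b - b')], so its zero [a] is not
   to the left of that point. *)
have : a' + (b - b') <= a.
  rewrite leNgt; apply/negP => /(excess_decr p v_gt0 A); rewrite Fa; lra.
lra.
Qed.
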